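(* Suppose that we are given finitely many lines $\ell_1,\ldots,\ell_m\subset\mathbb{R}^2$ and a positive number $\varepsilon$. There exists a finite Jordan-measurable coloring of $\mathbb{R}^2$ such that there is no parallelogram of area $1$ with all four vertices in the same color-class that, additionally, has one side parallel to some line $\ell_i$ or has all angles greater than $\varepsilon$.
   Context: A finite coloring of $\mathbb{R}^2$ is a partition of $\mathbb{R}^2$ into finitely many sets, called color-classes. It is Jordan-measurable if the boundary of every color-class has Lebesgue measure $0$. *)

(* Defs.v *)
From mathcomp Require Import all_boot all_order all_algebra.
From mathcomp Require Import all_classical all_reals all_analysis.

Set Implicit Arguments.
Unset Strict Implicit.
Unset Printing Implicit Defensive.

Import Order.TTheory GRing.Theory Num.Theory.
Import numFieldNormedType.Exports.

Local Open Scope classical_set_scope.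
Local Open Scope ring_scope.

Definition dot (R : realType) (u v : R * R) : R := u.1 * v.1 + u.2 * v.2.

(* The library norm on [R * R] is the sup norm, hence an explicit Euclidean
   length. *)
Definition enorm (R : realType) (u : R * R) : R := Num.sqrt (dot u u).

Definition cross (R : realType) (u v : R * R) : R := u.1 * v.2 - u.2 * v.1.

(* The angle p q r with apex q, in [0, pi] (meaningful for q <> p, r). *)
Definition angle (R : realType) (p q r : R * R) : R :=
  acos (dot (p - q) (r - q) / (enorm (p - q) * enorm (r - q))).

Definition line_through (R : realType) (p q : R * R) : set (R * R) :=
  [set x | exists t : R, x = (p.1 + t * (q.1 - p.1), p.2 + t * (q.2 - p.2))].

Definition is_line (R : realType) (l : set (R * R)) : Prop :=
  exists p q : R * R, p <> q /\ l = line_through p q.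

(* A line counts as parallel to itself. *)
Definition parallel (R : realType) (l l' : set (R * R)) : Prop :=
  l = l' \/ l `&` l' = set0.

(* [a], [b], [c], [d] are the vertices in cyclic order, so the sides are ab, bc,
   cd, da; the second condition excludes degenerate parallelograms. *)
Definition is_parallelogram (R : realType) (a b c d : R * R) : Prop :=
  b - a = c - d /\ cross (b - a) (d - a) <> 0.

Definition parallelogram_area (R : realType) (a b c d : R * R) : R :=
  `|cross (b - a) (d - a)|.

Definition has_side_parallel_to (R : realType) (a b c d : R * R)
    (l : set (R * R)) : Prop :=
  [\/ parallel (line_through a b) l, parallel (line_through b c) l,
      parallel (line_through c d) l | parallel (line_through d a) l].

Definition all_angles_gt (R : realType) (a b c d : R * R) (e : R) : Prop :=
  [/\ e < angle d a b, e < angle a b c, e < angle b c d & e < angle c d a].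

Definition boundary (T : topologicalType) (A : set T) : set T :=
  closure A `\` interior A.

(* The measure is the product of the Borel-Lebesgue measures; [negligible] (being
   contained in a measurable set of measure 0) is nullity for its completion. *)
Definition lebesgue_null (R : realType) (A : set (R * R)) : Prop :=
  (@lebesgue_measure R \x @lebesgue_measure R)%E.-negligible
    (A : set (measurableTypeR R * measurableTypeR R)).

Definition finite_coloring (R : realType) (C : set (set (R * R))) : Prop :=
  finite_set C /\ partition C id [set: R * R].

Definition jordan_measurable (R : realType) (C : set (set (R * R))) : Prop :=
  forall A, C A -> lebesgue_null (boundary A).

(* Main.v *)
Require Import Defs.
From mathcomp Require Import all_boot all_order all_algebra.
From mathcomp Require Import all_classical all_reals all_analysis.
From mathcomp Require Import measurable_realfun ring lra.

(** For a quadratic form q with polar form B, the alternating sum of q over the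
    vertices of the parallelogram a, a + u, a + u + v, a + v is B(u, v).  If the
    colour of p records floor (q p) modulo M, then on a monochromatic
    parallelogram B(u, v) is within 2 of a multiple of M, so it cannot satisfy
    2 <= |B(u, v)| <= M - 2.  For a side parallel to d we use
    q(p) = 2 (p . d) (d x p) / |d|^2, for which |B(u, v)| = 2 |u x v| = 2.  For
    angles bounded below we use the real and imaginary parts 2 (x^2 - y^2) and
    4 x y of 2 z^2: their polar forms have square sum 16 |u|^2 |v|^2, where
    |u| |v| = 1 / sin (angle) lies between 1 and 1 / sin eps.  The boundaries of
    the colour classes lie in the null sets where some q takes an integer
    value. *)

Import Order.TTheory GRing.Theory Num.Theory.
Import numFieldNormedType.Exports.

Local Open Scope classical_set_scope.
Local Open Scope ring_scope.

(** * Binary quadratic forms and residues of their floors *)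

Section QuadraticForms.
Context {R : realType}.
Implicit Types (w : R * R * R) (p u v : R * R).

Definition qform w p : R :=
  w.1.1 * p.1 ^+ 2 + w.1.2 * (p.1 * p.2) + w.2 * p.2 ^+ 2.

Definition qpolar w u v : R :=
  2 * w.1.1 * (u.1 * v.1) + w.1.2 * (u.1 * v.2 + u.2 * v.1)
  + 2 * w.2 * (u.2 * v.2).

Lemma qform_parallelogram w a b c d : b - a = c - d ->
  qform w a - qform w b + (qform w c - qform w d) = qpolar w (b - a) (d - a).
Proof.
case: a b c d => [a1 a2] [b1 b2] [c1 c2] [d1 d2] [e1 e2].
rewrite /qform /qpolar/=.
have -> : c1 = d1 + (b1 - a1) by rewrite e1; ring.
have -> : c2 = d2 + (b2 - a2) by rewrite e2; ring.
by ring.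
Qed.

Lemma continuous_qform w : continuous (qform w).
Proof.
move=> p; rewrite /qform.
have c1 : {for p, continuous (fun q : R * R => q.1)} by exact: cvg_fst.
have c2 : {for p, continuous (fun q : R * R => q.2)} by exact: cvg_snd.
apply: cvgD; first apply: cvgD.
- by apply: cvgMl_tmp; apply: cvgM.
- by apply: cvgMl_tmp; apply: cvgM.
- by apply: cvgMl_tmp; apply: cvgM.
Qed.

Lemma measurable_qform w :
  measurable_fun [set: measurableTypeR R * measurableTypeR R] (qform w).
Proof.
rewrite /qform; apply: measurable_funD; first apply: measurable_funD.
- by apply: measurable_funM => //; apply: measurable_funX; exact: measurable_fst.
- apply: measurable_funM => //; apply: measurable_funM.
    exact: measurable_fst.
  exact: measurable_snd.
- by apply: measurable_funM => //; apply: measurable_funX; exact: measurable_snd.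
Qed.

(* If [y0] is a root and [a != 0], the other one is [- b / a - y0]. *)
Lemma countable_quadratic_roots (a b c : R) : (a != 0) || (b != 0) ->
  countable [set y : R | a * y ^+ 2 + b * y + c = 0].
Proof.
set S := [set y | _]; move=> ab.
have [->|/set0P[y0 Sy0]] := eqVneq S set0; first exact: countable0.
apply: (@sub_countable _ _ _ [set y0; - b / a - y0]); last first.
  by apply: finite_set_countable.
apply: subset_card_le => y /= Sy; rewrite /S/= in Sy Sy0.
(* For [a = 0] the equation is linear, so [y = y0]; [- b / a] then has the default value [0]. *)
have [a0|a0] := eqVneq a 0; [left|].
  move: ab; rewrite a0 eqxx/= => b0; apply: (mulfI b0).
  by move: Sy Sy0; rewrite a0; lra.
have [->|yy0] := eqVneq y y0; [by left|right].
have yy : y - y0 != 0 by rewrite subr_eq0.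
apply: (mulfI a0); apply: (mulfI yy).
have -> : a * (- b / a - y0) = - b - a * y0 by field.
by apply: (addrI (- (y - y0) * (b + a * y0))); lra.
Qed.

Lemma countable_int : countable [set x : R | x \is a Num.int].
Proof.
apply: (@sub_countable _ _ _ [set: int]) => //.
rewrite (_ : [set x | _] = (intr : int -> R) @` [set: int]).
  exact: card_image_le.
apply/seteqP; split => [x /= /intrP[m ->]|x /= [m _ <-]]; first by exists m.
exact: intr_int.
Qed.

(** Off the integers [f x] lies strictly between its floor and the next integer, an open
    condition. *)
Lemma floor_locally_constant (T : topologicalType) (f : T -> R) (x : T) :
  {for x, continuous f} -> f x \isn't a Num.int ->
  \forall y \near x, Num.floor (f y) = Num.floor (f x).
Proof.
move=> fx fxN.
have lo : (Num.floor (f x))%:~R < f x.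
  by rewrite lt_neqAle floor_le -intrEfloor fxN.
have hi := floorD1_gt (f x).
near=> y; apply: floor_def; apply/andP; split.
  apply: ltW; near: y; exact: (cvgr_gt _ fx _ lo).
near: y; exact: (cvgr_lt _ fx _ hi).
Unshelve. all: by end_near.
Qed.

(** The four floors combine to a multiple of [M]; the fractional parts, with signs [+ - + -], add
    less than 2 in absolute value. *)
Lemma same_residue_gap (M : nat) (a b c d : R) :
  (Num.floor a = Num.floor b %[mod M])%Z ->
  (Num.floor c = Num.floor d %[mod M])%Z ->
  2 <= `|a - b + (c - d)| -> M%:R - 2 < `|a - b + (c - d)|.
Proof.
move=> /eqP; rewrite eqz_mod_dvd => /dvdzP[k ek].
move=> /eqP; rewrite eqz_mod_dvd => /dvdzP[l el].
have ek' : (Num.floor a)%:~R = (Num.floor b)%:~R + k%:~R * M%:R :> R.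
  have -> : Num.floor a = Num.floor b + k * M by rewrite -ek addrC subrK.
  by rewrite intrD intrM.
have el' : (Num.floor c)%:~R = (Num.floor d)%:~R + l%:~R * M%:R :> R.
  have -> : Num.floor c = Num.floor d + l * M by rewrite -el addrC subrK.
  by rewrite intrD intrM.
move: (floor_itv a) (floor_itv b) (floor_itv c) (floor_itv d).
rewrite !intrD !mulr1z => /andP[a1 a2] /andP[b1 b2] /andP[c1 c2] /andP[d1 d2].
set B := a - b + (c - d).
have near_mult : `|B - (k + l)%:~R * M%:R| < 2.
  by rewrite ltr_norml intrD /B; apply/andP; split; lra.
(* The zero multiple contradicts the lower bound 2; any other is at least [M] in absolute value. *)
case: (eqVneq (k + l) 0) => [kl0|kl0].
  by rewrite kl0 mul0r subr0 in near_mult; lra.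
move=> _.
have : M%:R <= `|(k + l)%:~R * M%:R| :> R.
  rewrite normrM normr_nat -[leLHS]mul1r ler_wpM2r// norm_intr_ge1 ?intr_int//.
  by rewrite intr_eq0.
have := ler_normD ((k + l)%:~R * M%:R - B) B; rewrite subrK distrC.
by move: near_mult; lra.
Qed.

End QuadraticForms.

(** * Parallel lines and angles in the plane *)

Section Geometry.
Context {R : realType}.
Implicit Types (p q u v a b c d : R * R) (l : set (R * R)).

Lemma line_through_left a b : line_through a b a.
Proof. by exists 0; case: a b => ? ? [? ?] /=; rewrite !mul0r !addr0. Qed.

Lemma line_through_right a b : line_through a b b.
Proof.
exists 1; case: a b => ? ? [? ?] /=.
by rewrite !mul1r !(addrC _ (_ - _)) !subrK.
Qed.

(** With a nonzero determinant, Cramer's rule gives a common point, so the lines are not disjoint;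
    if they are equal, [a] and [b] lie on the line through [p] and [q]. *)
Lemma parallel_cross a b p q :
  parallel (line_through a b) (line_through p q) -> cross (q - p) (b - a) = 0.
Proof.
case=> [E|E0].
  have := line_through_left a b; have := line_through_right a b; rewrite E.
  move=> [s ->] [t ->]; rewrite /cross/=; ring.
rewrite /cross/=; apply/eqP; apply: contraPT E0 => /= D; apply/eqP/set0P.
set D' := _ - _ in D.
pose s := ((q.1 - p.1) * (p.2 - a.2) - (q.2 - p.2) * (p.1 - a.1)) / D'.
pose t := ((b.1 - a.1) * (p.2 - a.2) - (b.2 - a.2) * (p.1 - a.1)) / D'.
exists (a.1 + s * (b.1 - a.1), a.2 + s * (b.2 - a.2)); split; first by exists s.
exists t; rewrite /s /t; move: D; rewrite /D' /= => D.
by congr (_, _); field.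
Qed.

(** Lagrange's identity in the plane. *)
Lemma dot2_cross2 u v : dot u v ^+ 2 + cross u v ^+ 2 = dot u u * dot v v.
Proof. by rewrite /dot /cross; ring. Qed.

Lemma dot_ge0 u : 0 <= dot u u.
Proof. by rewrite /dot -!expr2 addr_ge0 ?sqr_ge0. Qed.

Lemma sqr_enorm u : enorm u ^+ 2 = dot u u.
Proof. by rewrite sqr_sqrtr// dot_ge0. Qed.

Lemma lt_acos (e x : R) :
  0 < e <= pi -> -1 <= x <= 1 -> e < acos x -> x < cos e.
Proof.
move=> /andP[e0 epi] x1 ex; rewrite -[x]acosK ?in_itv//.
by rewrite ltr_cos// in_itv/= ?acos_ge0 ?acos_lepi// ltW.
Qed.

(* Consecutive angles are supplementary, so both exceeding [e] bounds the cosine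
   of each in absolute value by [cos e]. *)
Lemma angles_gt_norm_bound a b c d (e : R) : 0 < e < pi / 2 ->
  b - a = c - d -> cross (b - a) (d - a) ^+ 2 = 1 ->
  e < angle d a b -> e < angle a b c ->
  dot (b - a) (b - a) * dot (d - a) (d - a) * sin e ^+ 2 <= 1.
Proof.
move=> /andP[e0 e2] E; rewrite /angle.
have -> : c - b = d - a.
  by apply/eqP; rewrite subr_eq addrAC -addrA E addrC subrK.
rewrite -(opprB b a); set u := b - a; set v := d - a => cr.
have -> : enorm (- u) = enorm u by rewrite /enorm /dot/= !mulrNN.
have -> : dot (- u) v = - dot v u by rewrite /dot/=; ring.
rewrite [enorm u * _]mulrC mulNr; set N := enorm v * enorm u.
have N2 : N ^+ 2 = dot v u ^+ 2 + 1.
  rewrite exprMn !sqr_enorm -dot2_cross2; congr (_ + _).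
  by rewrite -cr /cross; ring.
have N0 : 0 < N.
  rewrite lt_neqAle mulr_ge0 ?sqrtr_ge0// andbT eq_sym.
  apply/eqP => N0; move: N2; rewrite N0; have := sqr_ge0 (dot v u); nra.
(* [x] is the cosine of the angle at [a], and [- x] that of the angle at [b]. *)
set x := dot v u / N.
have xN : dot v u = x * N by rewrite /x mulfVK ?gt_eqF.
have x1 : x ^+ 2 <= 1.
  have := sqr_ge0 x; move: N2; rewrite xN; have := sqr_ge0 N; nra.
have {x1} [x1 x1'] : -1 <= x <= 1 /\ -1 <= - x <= 1.
  by split; apply/andP; split; nra.
have epi : 0 < e <= pi by rewrite e0/=; have := pi_gt0 R; lra.
move=> /(lt_acos _ _ epi x1) h1 /(lt_acos _ _ epi x1') h2.
rewrite sin2cos2 -!sqr_enorm -exprMn [_ * enorm _]mulrC -/N.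
(* Since [N ^+ 2 * (1 - x ^+ 2) = 1], this comparison of cosines yields the bound. *)
have xC : x ^+ 2 <= cos e ^+ 2.
  by rewrite -subr_ge0 subr_sqr mulr_ge0//; lra.
have : N ^+ 2 * x ^+ 2 <= N ^+ 2 * cos e ^+ 2 by rewrite ler_wpM2l ?sqr_ge0.
by move: N2; rewrite xN [(x * N) ^+ 2]exprMn; lra.
Qed.

End Geometry.

(** * Null level sets, the residue coloring and the chosen forms *)

Section Coloring.
Context {R : realType}.
Implicit Types (w : R * R * R) (p q u v a b c d : R * R).

(** Fubini: for [x != 0] the vertical section is a countable union, over the integer values [k], of
    root sets of nonconstant polynomials in [y]. The single abscissa [x = 0], where [w.1.2 * x]
    vanishes, is null. *)
Lemma qform_int_null w : (w.1.2 != 0) || (w.2 != 0) ->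
  lebesgue_null [set p | qform w p \is a Num.int].
Proof.
move=> w0; set E := [set p | _].
have mE : measurable (E : set (measurableTypeR R * measurableTypeR R)).
  have mint : measurable [set x : R | x \is a Num.int].
    by apply: countable_measurable => //; exact: countable_int.
  by have := measurable_qform w measurableT _ mint; rewrite setTI.
apply/(negligibleP _ mE); rewrite /= /product_measure1.
rewrite (ae_eq_integral (cst 0%E)) ?integral0//.
  exact: (measurable_fun_xsection lebesgue_measure).
exists [set 0]; split => //; first exact: lebesgue_measure_set1.
move=> x /=; apply: contra_notP => /= x0 _.
apply: countable_lebesgue_measure0.
rewrite (_ : xsection _ _ = \bigcup_(k in [set: int])
    [set y | w.2 * y ^+ 2 + (w.1.2 * x) * y + (w.1.1 * x ^+ 2 - k%:~R) = 0]).
  apply: bigcup_countable => // k _; apply: countable_quadratic_roots.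
  by rewrite mulf_eq0 negb_or orbC (introN eqP x0) andbT.
apply/seteqP; split => y.
  move=> /xsectionP/intrP[k]; rewrite /qform/= => kE; exists k => //=.
  by rewrite -kE; ring.
move=> [k _ /= kE]; apply/xsectionP/intrP; exists k; rewrite /qform/=.
by apply/eqP; rewrite -subr_eq0 -[X in _ == X]kE; apply/eqP; ring.
Qed.

Lemma lebesgue_nullS (A B : set (R * R)) :
  A `<=` B -> lebesgue_null B -> lebesgue_null A.
Proof.
exact: (@negligibleS _ _ _ (lebesgue_measure \x lebesgue_measure)%E).
Qed.

Lemma lebesgue_null_bigsetU (J : finType) (A : J -> set (R * R)) :
  (forall j, lebesgue_null (A j)) ->
  lebesgue_null (\big[setU/set0]_(j : J) A j).
Proof.
move=> A0; apply: big_ind => // [|B D B0 D0].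
  exact: (@negligible_set0 _ _ _ (lebesgue_measure \x lebesgue_measure)%E).
exact: (@negligibleU _ _ _ (lebesgue_measure \x lebesgue_measure)%E).
Qed.

Lemma residue_coloring (J : finType) (w : J -> R * R * R) (M : nat) :
  (0 < M)%N -> (forall j, ((w j).1.2 != 0) || ((w j).2 != 0)) ->
  exists C : set (set (R * R)),
    [/\ finite_coloring C, jordan_measurable C &
      forall A p q, C A -> A p -> A q -> forall j,
        (Num.floor (qform (w j) p) = Num.floor (qform (w j) q) %[mod M])%Z].
Proof.
move=> M0 w0.
(* [inord] needs a successor bound; residues are below [M], so no two are identified. *)
pose col p : {ffun J -> 'I_M.+1} :=
  [ffun j => inord `|(Num.floor (qform (w j) p) %% M)%Z|%N].
have colE p q : col p = col q -> forall j,
    (Num.floor (qform (w j) p) = Num.floor (qform (w j) q) %[mod M])%Z.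
  move=> + j => /ffunP/(_ j); rewrite !ffunE => /(congr1 val).
  have M0' : M%:Z != 0 by rewrite -lt0n.
  have lt x : (`|(x %% M)%Z| < M.+1)%N.
    by rewrite ltnS ltnW// -ltz_nat gez0_abs ?modz_ge0// ltz_mod.
  rewrite /= !inordK// => E.
  by rewrite -[LHS]gez0_abs ?modz_ge0// E gez0_abs// modz_ge0.
(* Only colors in [range col] are kept, because the blocks of a partition are nonempty. *)
exists [set col @^-1` [set k] | k in range col]; split.
- split; first by apply: finite_image; exact: finite_finset.
  split.
  + apply/seteqP; split => // p _; exists (col @^-1` [set col p]) => //.
    by exists (col p) => //; exists p.
  + move=> _ _ [k _ <-] [k' _ <-] [p /= [kp k'p]].
    by rewrite -kp -k'p.
  + by move=> _ [_ [p _ <-] <-]; exists p.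
- move=> _ [k _ <-].
  suff : boundary (col @^-1` [set k]) `<=`
      \big[setU/set0]_(j : J) [set p | qform (w j) p \is a Num.int].
    move=> sub; apply: lebesgue_nullS sub _.
    by apply: lebesgue_null_bigsetU => j; exact: qform_int_null.
  (* Where no form is integral the color is locally constant, so a point of the closure is
     interior. *)
  move=> p [clp nintp]; apply: contrapT => pN; apply: nintp.
  have locp : \forall q \near p, col q = col p.
    have : \forall q \near p, forall j,
        Num.floor (qform (w j) q) = Num.floor (qform (w j) p).
      apply: (filter_forall (nbhs_filter p)) => j.
      apply: (floor_locally_constant _ (qform (w j)) p).
        exact: continuous_qform.
      by apply: contra_notN pN => pE; rewrite (bigD1 j)//; left.
    apply: filterS => q qE; by apply/ffunP => j; rewrite !ffunE qE.
  have [q /= [qk qp]] := clp _ locp.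
  by apply: filterS locp => r /= ->; rewrite -qp.
- by move=> _ p q [k _ <-] /= pk qk; apply: colE; rewrite pk qk.
Qed.

(* The form [p |-> 2 (p . d) (d x p) / |d|^2]. *)
Definition line_qform (d : R * R) : R * R * R :=
  let D := dot d d in
  (- 2 * d.1 * d.2 / D, 2 * (d.1 ^+ 2 - d.2 ^+ 2) / D, 2 * d.1 * d.2 / D).

Lemma dot_gt0 u : u != 0 -> 0 < dot u u.
Proof.
rewrite lt_neqAle dot_ge0 andbT [0 == _]eq_sym; apply: contra_neq.
rewrite /dot -!expr2 => /eqP; rewrite paddr_eq0 ?sqr_ge0// !sqrf_eq0.
by case: u => u1 u2 /= /andP[/eqP-> /eqP->].
Qed.

(** If both coefficients vanish, then [d.1 ^+ 2 = d.2 ^+ 2] and [d.1 * d.2 = 0], which forces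
    [d = 0]. *)
Lemma line_qform_neq0 d : d != 0 ->
  ((line_qform d).1.2 != 0) || ((line_qform d).2 != 0).
Proof.
move=> d0; have /gt_eqF/negbT D0 := dot_gt0 _ d0; rewrite /line_qform /=.
rewrite !mulf_eq0 !invr_eq0 (negbTE D0) !pnatr_eq0/= !orbF -negb_and.
apply: contra d0 => /andP[]; rewrite subr_eq0 => /eqP e /orP[]/eqP z.
  move: e; rewrite z expr0n/= => /esym/eqP; rewrite sqrf_eq0 => /eqP z'.
  by apply/eqP; case: d z z' {D0} => ? ? /= -> ->.
move: e; rewrite z expr0n/= => /eqP; rewrite sqrf_eq0 => /eqP z'.
by apply/eqP; case: d z z' {D0} => ? ? /= -> ->.
Qed.

(** Multiplied by [dot d d], the polar form is [2 (s + t)] and the cross product [s - t], where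
    [s = dot u d * cross d v] and [t = cross d u * dot v d]. A side along [d] kills [s] or [t]. *)
Lemma qpolar_line_qform d u v : d != 0 -> cross d u = 0 \/ cross d v = 0 ->
  qpolar (line_qform d) u v ^+ 2 = 4 * cross u v ^+ 2.
Proof.
move=> /dot_gt0 /gt_eqF/negbT D0 duv.
have polarE : qpolar (line_qform d) u v * dot d d =
    2 * (dot u d * cross d v + cross d u * dot v d).
  by rewrite /qpolar /=; move: D0; rewrite /dot /cross => D0; field.
have crossE : cross u v * dot d d = dot u d * cross d v - cross d u * dot v d.
  by rewrite /dot /cross; ring.
apply: (mulIf (expf_neq0 2 D0)); rewrite -[RHS]mulrA -!exprMn polarE crossE.
by case: duv => ->; ring.
Qed.

(** In complex notation the two polar forms are the real and imaginary parts of [4 u v]. *)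
Lemma qpolar_sqr u v :
  qpolar (2, 0, - 2) u v ^+ 2 + qpolar (0, 4, 0) u v ^+ 2 =
  16 * (dot u u * dot v v).
Proof. by rewrite /qpolar /dot /=; ring. Qed.

End Coloring.

Theorem theorem6 (R : realType) (m : nat) (l : 'I_m -> set (R * R)) (eps : R)
    (hl : forall i : 'I_m, is_line (l i)) (heps : 0 < eps) :
  exists C : set (set (R * R)),
    [/\ finite_coloring C, jordan_measurable C &
      ~ exists (A : set (R * R)) (a b c d : R * R),
          [/\ C A, [/\ A a, A b, A c & A d],
              is_parallelogram a b c d, parallelogram_area a b c d = 1 &
              (exists i : 'I_m, has_side_parallel_to a b c d (l i)) \/
              all_angles_gt a b c d eps]].
Proof.
have dir_ex i : exists d : R * R, d != 0 /\
    forall a b, parallel (line_through a b) (l i) -> cross d (b - a) = 0.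
  have [p [q [pq ->]]] := hl i; exists (q - p); split.
    by rewrite subr_eq0 eq_sym; exact/eqP.
  by move=> a b; exact: parallel_cross.
have [dir dirP] := choice dir_ex.
(* A smaller angle bound only excludes more parallelograms; this one lies below [pi / 2]. *)
pose e := Num.min eps 2^-1.
have e0 : 0 < e by rewrite lt_min heps invr_gt0/=.
have e2 : 0 < e < pi / 2.
  rewrite e0/= (@le_lt_trans _ _ 2^-1) ?ge_min ?lexx ?orbT//.
  by have := pihalf_ge1 R; lra.
have s0 : 0 < sin e by exact: sin_gt0_pihalf.
(* [4 / sin e] will bound both polar forms in the angle case; the extra 4 puts [M - 2] above
   [2 + 4 / sin e]. *)
have [M M0 MC] : exists2 M, (0 < M)%N & 4 / sin e + 4 < M%:R :> R.
  exists ((Num.truncn (4 / sin e)).+1 + 4)%N => //.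
  by rewrite natrD ltrD2r truncnS_gt.
have C0 : 0 <= 4 / sin e by rewrite divr_ge0// ltW.
pose w (j : bool + 'I_m) : R * R * R := match j with
  | inl false => (2, 0, - 2) | inl true => (0, 4, 0)
  | inr i => line_qform (dir i) end.
have [j|C [finC jorC colC]] := @residue_coloring R _ w M M0.
  case: j => [[]|i] /=; last by apply: line_qform_neq0; have [] := dirP i.
    by rewrite pnatr_eq0.
  by rewrite oppr_eq0 pnatr_eq0 orbT.
exists C; split => // -[A [a [b [c [d [CA [Aa Ab Ac Ad] [E _] area1]]]]]].
set u := b - a; set v := d - a.
have uv1 : cross u v ^+ 2 = 1.
  by move: area1; rewrite /parallelogram_area => /(congr1 (fun x => x ^+ 2));
     rewrite real_normK ?num_real// expr1n.
have cbE : c - b = v.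
  by apply/eqP; rewrite subr_eq addrC addrA addrAC -/u /u E subrK.
have gap j : 2 <= `|qpolar (w j) u v| -> 2 + 4 / sin e < `|qpolar (w j) u v|.
  rewrite -(qform_parallelogram _ _ _ _ _ E) => B2.
  have := same_residue_gap M _ _ _ _
    (colC A a b CA Aa Ab j) (colC A c d CA Ac Ad j) B2.
  by apply: le_lt_trans; rewrite lerBrDr; apply: ltW; move: MC; lra.
have sqn j : `|qpolar (w j) u v| ^+ 2 = qpolar (w j) u v ^+ 2.
  by rewrite real_normK// num_real.
case=> [[i pari]|[a1 a2 _ _]].
  have [di0 dirl] := dirP i.
  have duv : cross (dir i) u = 0 \/ cross (dir i) v = 0.
    have crossN x y : cross x (- y) = - cross x y :> R.
      by rewrite /cross/=; ring.
    (* The four sides have directions [u], [v], [- u] and [- v]. *)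
    case: pari => /dirl; rewrite ?cbE.
    + by left.
    + by right.
    + by rewrite -opprB -E crossN => /eqP; rewrite oppr_eq0 => /eqP; left.
    + by rewrite -opprB crossN => /eqP; rewrite oppr_eq0 => /eqP; right.
  move: (gap (inr i)) (sqn (inr i)).
  rewrite /= (qpolar_line_qform _ _ _ di0 duv) uv1.
  set y := `|_| => g y2; have y0 : 0 <= y by exact: normr_ge0.
  (* Area 1 makes the value exactly 2, the lower end of the forbidden range. *)
  have yE : y = 2 by nra.
  by move: g; rewrite yE lexx => /(_ isT); lra.
have a1' : e < angle d a b by rewrite (le_lt_trans _ a1)// ge_min lexx.
have a2' : e < angle a b c by rewrite (le_lt_trans _ a2)// ge_min lexx.
have := angles_gt_norm_bound _ _ _ _ _ e2 E uv1 a1' a2'.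
have := dot2_cross2 u v; rewrite uv1.
have := qpolar_sqr u v; rewrite -(sqn (inl false)) -(sqn (inl true)) -/u -/v.
set S := dot u u * dot v v => B2 S1 Ss.
have S1' : 1 <= S by rewrite -S1 lerDr sqr_ge0.
have SC : 16 * S <= (4 / sin e) ^+ 2.
  rewrite expr_div_n ler_pdivlMr ?exprn_gt0//; lra.
(* A value of at most [4 / sin e] cannot lie beyond the gap, so it is below 2. *)
have small j : `|qpolar (w j) u v| ^+ 2 <= 16 * S -> `|qpolar (w j) u v| < 2.
  move=> /le_trans/(_ SC) jC; rewrite ltNge; apply/negP => /gap.
  move: jC; rewrite ler_sqr ?nnegrE//; lra.
have := small (inl false); have := small (inl true); move: B2.
set y := `|_|; set z := `|_|.
have y0 : 0 <= y by exact: normr_ge0.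
have z0 : 0 <= z by exact: normr_ge0.
have := sqr_ge0 y; have := sqr_ge0 z => z2 y2 B2.
(* Two squares below 4 cannot sum to [16 * S], which is at least 16. *)
by move=> /(_ ltac:(lra)) hz /(_ ltac:(lra)) hy; nra.
Qed.
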